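(* Fix a centrally symmetric polygon $Q$ and the map $\eta^B$ from $B_n$ to centrally symmetric triangulations of $Q$ as described below. Then the fibers of $\eta^B$ are exactly the congruence classes of a lattice congruence of the weak order on $B_n$.
   Context: $B_n$ is the group of signed permutations: permutations $x$ of $\pm[n]=\{\pm1,\dots,\pm n\}$ with $x(-i)=-x(i)$; the full notation of $x$ is the sequence $x_{-n},\dots,x_{-1},x_1,\dots,x_n$ with $x_i=x(i)$. Its Coxeter generators are $s_0=(-1\ 1)$ and $s_i=(i\ i{+}1)(-i{-}1\ {-i})$ for $i\in[n-1]$. The weak order is $v\le w$ iff $I(v)\subseteq I(w)$, where $I(w)$ is the set of reflections $t$ with $\ell(tw)<\ell(w)$; it is a lattice. Let $Q$ be a convex $(2n+2)$-gon in $\mathbb R^2$ with vertices $v_i$, $i\in\{\pm1,\dots,\pm(n+1)\}$, symmetric under $v\mapsto -v$ with $v_{-i}=-v_i$, whose $x$-coordinates strictly increase in the order $-n-1<\dots<-1<1<\dots<n+1$, with $v_{\pm(n+1)}$ on the $x$-axis; call $i$ up if $v_i$ has positive $y$-coordinate and down otherwise (so $i$ is up iff $-i$ is down). For a signed permutation $x$ list its full notation as $y_1,\dots,y_{2n}$; define paths $\lambda_0,\dots,\lambda_{2n}$ from $v_{-n-1}$ to $v_{n+1}$ visiting vertices in increasing order of index: $\lambda_0$ visits $v_{-n-1}$, all down vertices, and $v_{n+1}$; $\lambda_k$ is $\lambda_{k-1}$ with $v_{y_k}$ deleted if $y_k$ is down and added if $y_k$ is up. $\eta^B(x)$ is the set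 of diagonals (segments between non-adjacent vertices) of $Q$ appearing as edges of some $\lambda_k$; it is a centrally symmetric triangulation of $Q$. *)

(* Defs.v *)
From HB Require Import structures.
From mathcomp Require Import all_boot all_order all_algebra all_fingroup.
Unset Printing Implicit Defensive.
Import GRing.Theory Num.Theory.

(* ---------- Signed indices ----------
   The set +-[n] = {-n,...,-1,1,...,n} is encoded by the ordinals 'I_(n.*2),
   in increasing order: ordinal k stands for the signed value [sv n k]
   (k = 0 |-> -n, ..., k = n-1 |-> -1, k = n |-> 1, ..., k = 2n-1 |-> n).
   Negation i |-> -i is [rev_ord].  *)
Definition sv (n : nat) (k : 'I_(n.*2)) : int :=
  if (k < n)%N then (- Posz (n - k)%N)%R else Posz (k - n).+1.

Definition Bn (n : nat) : {set {perm 'I_(n.*2)}} :=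
  [set x : {perm 'I_(n.*2)} | [forall k, x (rev_ord k) == rev_ord (x k)]].

Definition sgen (i : nat) (z : int) : int :=
  let a := Posz i in
  if i == 0%N then
    (if z == 1%R then (-1)%R else if z == (-1)%R then 1%R else z)
  else
    (if z == a then a + 1 else if z == a + 1 then a
     else if z == - a then - a - 1 else if z == - a - 1 then - a else z)%R.

Definition gens (n : nat) : {set {perm 'I_(n.*2)}} :=
  [set g : {perm 'I_(n.*2)} |
     [exists i : 'I_n, [forall k, sv n (g k) == sgen i (sv n k)]]].

(* product of a word; note (g * h)%g is the function "first g, then h" *)
Definition wprod (n : nat) (s : seq {perm 'I_(n.*2)}) : {perm 'I_(n.*2)} :=
  foldr (fun a b => (a * b)%g) 1%g s.

Definition is_length (n : nat) (w : {perm 'I_(n.*2)}) (l : nat) : Prop :=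
  (exists s : seq {perm 'I_(n.*2)},
      all (mem (gens n)) s /\ size s = l /\ wprod n s = w) /\
  (forall s : seq {perm 'I_(n.*2)},
      all (mem (gens n)) s -> wprod n s = w -> (l <= size s)%N).

Definition refls (n : nat) : {set {perm 'I_(n.*2)}} :=
  [set ((w^-1 * s) * w)%g | w in Bn n, s in gens n].

(* t \in I(w): t is a reflection with l(tw) < l(w); as functions
   tw = t o w, which is (w * t)%g in MathComp's convention *)
Definition inv_set (n : nat) (w t : {perm 'I_(n.*2)}) : Prop :=
  t \in refls n /\
  exists l l', is_length n w l /\ is_length n (w * t)%g l' /\ (l' < l)%N.

Definition weak_le (n : nat) (v w : {perm 'I_(n.*2)}) : Prop :=
  forall t, inv_set n v t -> inv_set n w t.

Definition is_meet (n : nat) (m x y : {perm 'I_(n.*2)}) : Prop :=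
  m \in Bn n /\ weak_le n m x /\ weak_le n m y /\
  (forall z, z \in Bn n -> weak_le n z x -> weak_le n z y -> weak_le n z m).

Definition is_join (n : nat) (j x y : {perm 'I_(n.*2)}) : Prop :=
  j \in Bn n /\ weak_le n x j /\ weak_le n y j /\
  (forall z, z \in Bn n -> weak_le n x z -> weak_le n y z -> weak_le n j z).

Definition lattice_congruence (n : nat)
    (r : {perm 'I_(n.*2)} -> {perm 'I_(n.*2)} -> Prop) : Prop :=
  (forall x, x \in Bn n -> r x x) /\
  (forall x y, x \in Bn n -> y \in Bn n -> r x y -> r y x) /\
  (forall x y z, x \in Bn n -> y \in Bn n -> z \in Bn n ->
      r x y -> r y z -> r x z) /\
  (forall x y z m m', x \in Bn n -> y \in Bn n -> z \in Bn n ->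
      r x y -> is_meet n m x z -> is_meet n m' y z -> r m m') /\
  (forall x y z j j', x \in Bn n -> y \in Bn n -> z \in Bn n ->
      r x y -> is_join n j x z -> is_join n j' y z -> r j j').

(* ---------- The polygon Q and the map eta^B ----------
   Vertex labels +-[n+1] are encoded by 'I_(n.*2).+2 in increasing order:
   ord0 = -(n+1), ord_max = n+1, and [lab k] is the vertex whose label is
   the signed value of k : 'I_(n.*2).  The geometry of Q enters only through
   [up : 'I_(n.*2) -> bool] (i is up iff v_i has positive y-coordinate). *)
Definition lab (n : nat) (k : 'I_(n.*2)) : 'I_(n.*2).+2 :=
  lift ord0 (widen_ord (leqnSn _) k).

Notation vert n := ('I_(n.*2).+2).

(* (a,b) is an edge of the path through the vertex set S visited in
   increasing order of index *)
Definition path_edge (n : nat) (S : {set vert n}) (e : vert n * vert n) : bool :=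
  [&& e.1 \in S, e.2 \in S, (e.1 < e.2)%N &
      [forall c in S, ~~ ((e.1 < c)%N && (c < e.2)%N)]].

Definition upper_chain (n : nat) (up : 'I_(n.*2) -> bool) : {set vert n} :=
  [set ord0; ord_max] :|: [set lab n k | k in [set k | up k]].
Definition lower_chain (n : nat) (up : 'I_(n.*2) -> bool) : {set vert n} :=
  [set ord0; ord_max] :|: [set lab n k | k in [set k | ~~ up k]].

Definition diagonal (n : nat) (up : 'I_(n.*2) -> bool) (e : vert n * vert n) : bool :=
  [&& (e.1 < e.2)%N, ~~ path_edge n (upper_chain n up) e &
      ~~ path_edge n (lower_chain n up) e].

(* the paths lambda_k, k = 0..2n; the full notation of x is
   y_1,...,y_2n with y_(j+1) = x (ordinal j) *)
Definition lambda0 (n : nat) (up : 'I_(n.*2) -> bool) : {set vert n} :=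
  lower_chain n up.

Definition lambda_step (n : nat) (up : 'I_(n.*2) -> bool) (x : {perm 'I_(n.*2)})
    (S : {set vert n}) (j : 'I_(n.*2)) : {set vert n} :=
  if up (x j) then lab n (x j) |: S else S :\ lab n (x j).

Definition lambda (n : nat) (up : 'I_(n.*2) -> bool) (x : {perm 'I_(n.*2)})
    (k : nat) : {set vert n} :=
  foldl (lambda_step n up x) (lambda0 n up) (take k (enum 'I_(n.*2))).

Definition etaB (n : nat) (up : 'I_(n.*2) -> bool) (x : {perm 'I_(n.*2)})
    : {set vert n * vert n} :=
  [set e | diagonal n up e &&
           [exists k : 'I_(n.*2).+1, path_edge n (lambda n up x k) e]].

(* Main.v *)
(** A diagonal [(p, q)] belongs to the triangulation of [x] iff, in the word of
    [x], the up vertices among [p, q] and the down vertices strictly between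
    them all precede the down vertices among [p, q] and the up vertices strictly
    between them.  Call a pair [i < j] forced in [x] if, for all [l < e] in
    [[i, j]] such that [l] is [i] or up and [e] is [j] or down, [e] precedes [l]
    in [x].  The forced pairs and the triangulation determine each other.  The
    set of forced pairs and its complement are both transitive, so it is the
    inversion set of a signed permutation [pi x], which lies below [x] in the
    same fiber, and [x <= y] implies [pi x <= pi y].  If [x] and [y] lie in one
    fiber, then [pi (x /\ z)] is below [y] and [z], hence below [y /\ z]; by
    symmetry [x /\ z] and [y /\ z] lie in one fiber.  Joins follow by reversing
    words and exchanging up and down.

    On [B_n], the order by inclusion of the sets [I(w)] is the order by inclusion
    of sets of inverted pairs of values, by the exchange property. *)

Require Import Defs.
From HB Require Import structures.
From mathcomp Require Import all_boot all_order all_algebra all_fingroup.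
From mathcomp Require Import zify.

Set Implicit Arguments.
Unset Strict Implicit.
Local Open Scope nat_scope.

(** * Forced pairs and their closure properties *)

(** Here [x] sends a value to its position in a word (later [pos w]), so [x e < x l] says that [e]
    precedes [l]. *)
Definition forced N (up : 'I_N -> bool) (x : 'I_N -> nat) (i j : 'I_N) : bool :=
  [forall l : 'I_N, forall e : 'I_N,
    [&& i <= l, l < e, e <= j, (l == i) || up l & (e == j) || ~~ up e]
      ==> (x e < x l)].

(* [p] and [q] number the vertices of the polygon: the value [v : 'I_N] is the
   vertex [v.+1], while [0] and [N.+1] are the two extreme vertices. *)
Definition early N (up : 'I_N -> bool) (p q : nat) (v : 'I_N) : bool :=
  if up v then (v.+1 == p) || (v.+1 == q) else p < v.+1 < q.

Definition late N (up : 'I_N -> bool) : nat -> nat -> 'I_N -> bool :=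
  early (fun v => ~~ up v).

(** Criterion for [(p, q)] to be an edge of some path: at time [k] the vertices [p] and [q] are
    present and all vertices between them absent iff the early values have positions below [k] and
    the late ones do not. *)
Definition separated N (up : 'I_N -> bool) (x : 'I_N -> nat) (p q : nat) :=
  forall e l, early up p q e -> late up p q l -> x e < x l.

Lemma forcedP N (up : 'I_N -> bool) (x : 'I_N -> nat) (i j : 'I_N) :
  reflect (forall l e : 'I_N, i <= l -> l < e -> e <= j ->
             (l == i) || up l -> (e == j) || ~~ up e -> x e < x l)
          (forced up x i j).
Proof.
apply: (iffP idP) => [/forallP F l e h1 h2 h3 h4 h5|F].
  have /forallP /(_ e) /implyP := F l; apply.
  by rewrite h1 h2 h3 h4 h5.
apply/forallP=> l; apply/forallP=> e; apply/implyP=> /and5P[*]; exact: F.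
Qed.

Lemma forced_inv N (up : 'I_N -> bool) (x : 'I_N -> nat) (i j : 'I_N) :
  i < j -> forced up x i j -> x j < x i.
Proof. by move=> ij /forcedP; apply; rewrite ?eqxx. Qed.

Lemma forced_mono N (up : 'I_N -> bool) (x y : 'I_N -> nat) (i j : 'I_N) :
  (forall a b : 'I_N, a < b -> x b < x a -> y b < y a) ->
  forced up x i j -> forced up y i j.
Proof. by move=> xy /forcedP F; apply/forcedP=> l e *; apply: xy => //; apply: F. Qed.

(** The conditions on [a] and [b] make every pair compared for [[a, b]] one already compared for
    [[i, j]]. *)
Lemma forced_sub N (up : 'I_N -> bool) (x : 'I_N -> nat) (i j a b : 'I_N) :
  i <= a -> b <= j -> (a == i) || up a -> (b == j) || ~~ up b ->
  forced up x i j -> forced up x a b.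
Proof.
move=> ia bj ha hb /forcedP F; apply/forcedP=> l e al le eb hl he.
apply: F => //; [lia|lia| |].
  by case/orP: hl => [/eqP->//|->]; rewrite orbT.
by case/orP: he => [/eqP->//|->]; rewrite orbT.
Qed.

(** A compared pair [l < k < e] is handled through [k], which is compared as right end of [[i, k]]
    and as left end of [[k, j]]. *)
Lemma forced_trans N (up : 'I_N -> bool) (x : 'I_N -> nat) (i k j : 'I_N) :
  i < k -> k < j -> forced up x i k -> forced up x k j -> forced up x i j.
Proof.
move=> ik kj /forcedP F /forcedP G; apply/forcedP=> l e il le ej hl he.
have [ke|ek] := leqP e k.
  apply: F => //; case/orP: he => [/eqP ee|->]; last by rewrite orbT.
  by move: ke; rewrite ee; lia.
have [kl|lk] := leqP k l.
  apply: G => //; case/orP: hl => [/eqP ee|->]; last by rewrite orbT.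
  by move: kl; rewrite ee; lia.
apply: (@ltn_trans (x k)).
  by apply: G => //; rewrite ?eqxx.
by apply: F => //; rewrite ?eqxx.
Qed.

(** By [forced_sub]: an up [k] may serve as a left end, a down [k] as a right end. *)
Lemma forced_cotrans N (up : 'I_N -> bool) (x : 'I_N -> nat) (i k j : 'I_N) :
  i < k -> k < j -> forced up x i j -> forced up x i k || forced up x k j.
Proof.
move=> ik kj F; apply/orP; case uk: (up k); [right|left].
  by apply: forced_sub F; rewrite ?eqxx ?uk ?orbT //; lia.
by apply: forced_sub F; rewrite ?eqxx ?uk ?orbT //; lia.
Qed.

(** This puts the projection of a word into the fiber of that word. *)
Lemma forced_idem N (up : 'I_N -> bool) (x y : 'I_N -> nat) :
  (forall a b : 'I_N, a < b -> (y b < y a) = forced up x a b) ->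
  forall i j : 'I_N, i < j -> forced up y i j = forced up x i j.
Proof.
move=> yE i j ij; apply/idP/idP => [/(forced_inv ij)|F]; first by rewrite yE.
by apply/forcedP=> l e *; rewrite yE //; apply: forced_sub F.
Qed.

(** * Separated vertex pairs and forced pairs determine each other *)

(** The right-hand side mentions [x] only through its forced pairs. From left to right, the members
    of [[l, e]] that [forced] compares are themselves late and early. *)
Lemma separated_forced N (up : 'I_N -> bool) (x : 'I_N -> nat) (p q : nat) :
  injective x -> p < q ->
  separated up x p q <->
  (forall e l : 'I_N, early up p q e -> late up p q l ->
     if l < e then forced up x l e else ~~ forced up x e l).
Proof.
move=> xI pq; split=> [S e l he hl|S].
  have [le|el] := ltnP l e.
    apply/forcedP=> l' e' ll le' ee hl' he'; apply: S.
      have [->//|ne] := eqVneq e' e; move: he'; rewrite (negbTE ne) /=.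
      by move: he hl ne; rewrite -val_eqE /late /early;
        case: (up e'); case: (up e); case: (up l) => //=; lia.
    have [->//|ne] := eqVneq l' l; move: hl'; rewrite (negbTE ne) /=.
    by move: he hl ne; rewrite -val_eqE /late /early;
      case: (up l'); case: (up e); case: (up l) => //=; lia.
  have := S _ _ he hl => xel.
  have {}el : e < l.
    rewrite ltn_neqAle el andbT; apply: contraTneq xel => /val_inj->.
    by rewrite ltnn.
  by apply/negP=> /(forced_inv el); lia.
move=> e l.
have [m] := ubnP (l - e); elim: m => // m IH in e l *.
move=> lm he hl.
have := S _ _ he hl.
have [le /(forced_inv le)//|el nF] := ltnP l e.
rewrite ltnNge; apply/negP=> xle.
have nel : e != l.
  apply: contraTneq he => ee; move: hl; rewrite ee /late /early.
  by case: (up l) => /=; lia.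
have {}xle : x l < x e.
  rewrite ltn_neqAle xle andbT; apply: contra nel => /eqP/xI->//.
have {}el : e < l by rewrite ltn_neqAle el andbT.
(* If [l] preceded [e], the pair [(e, l)] would be forced: apart from the ends, [l0] is late and
   [e0] is early, so a violation [x l0 < x e0] contradicts [S] or the induction hypothesis on a
   closer pair. *)
case/negP: nF; apply/forcedP=> l0 e0 h1 h2 h3 hl0 he0.
have hl0' : l0 != e -> late up p q l0.
  move=> ne; move: hl0; rewrite (negbTE ne) /= => ul0.
  move: ne he hl; rewrite -val_eqE /late /early ul0 /=;
  case: (up e); case: (up l) => //=; lia.
have he0' : e0 != l -> early up p q e0.
  move=> ne; move: he0; rewrite (negbTE ne) /= => /negbTE ul0.
  move: ne he hl; rewrite -val_eqE /late /early ul0 /=;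
  case: (up e); case: (up l) => //=; lia.
rewrite ltnNge; apply/negP => xl0.
have {}xl0 : x l0 < x e0.
  rewrite ltn_neqAle xl0 andbT; apply: contraTneq h2 => /xI->; by rewrite ltnn.
have [E0|N0] := eqVneq l0 e; have [E1|N1] := eqVneq e0 l.
- by subst; lia.
- subst l0; have : x e0 < x l by apply: IH => //; [lia|exact: he0'].
  lia.
- subst e0; have : x e < x l0 by apply: IH => //; [lia|exact: hl0'].
  lia.
- have := S _ _ (he0' N1) (hl0' N0); rewrite h2 => /(forced_inv h2); lia.
Qed.

(** Heads and tails are the values that [forced] lets play [e] and [l]. A forced pair compares a
    head and a tail only when the tail is the smaller value, whereas an edge can separate all heads
    from all tails at once. *)
Definition head N (up : 'I_N -> bool) (i j v : 'I_N) : bool :=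
  (v == j) || ~~ up v && (i < v < j).

Definition tail N (up : 'I_N -> bool) (i j v : 'I_N) : bool :=
  (v == i) || up v && (i < v < j).

Lemma head_range N (up : 'I_N -> bool) (i j v : 'I_N) :
  i < j -> head up i j v -> i < v <= j.
Proof. by move=> ij /orP[/eqP->|/andP[_]]; lia. Qed.

Lemma tail_range N (up : 'I_N -> bool) (i j v : 'I_N) :
  i < j -> tail up i j v -> i <= v < j.
Proof. by move=> ij /orP[/eqP->|/andP[_]]; lia. Qed.

Lemma head_of_range N (up : 'I_N -> bool) (i j v : 'I_N) :
  i < v -> v <= j -> (v == j) || ~~ up v -> head up i j v.
Proof.
move=> iv vj /orP[/eqP->|uv]; first by rewrite /head eqxx.
by rewrite /head uv iv -val_eqE /= -leq_eqVlt.
Qed.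

Lemma tail_of_range N (up : 'I_N -> bool) (i j v : 'I_N) :
  i <= v -> v < j -> (v == i) || up v -> tail up i j v.
Proof.
move=> iv vj /orP[/eqP->|uv]; first by rewrite /tail eqxx.
by rewrite /tail uv vj andbT -val_eqE /= eq_sym -leq_eqVlt.
Qed.

Lemma forced_of_heads N (up : 'I_N -> bool) (x : 'I_N -> nat) (i j : 'I_N) :
  (forall e l, head up i j e -> tail up i j l -> x e < x l) -> forced up x i j.
Proof.
move=> H; apply/forcedP=> l e il le ej hl he; apply: H.
  by apply: head_of_range => //; apply: leq_ltn_trans le.
by apply: tail_of_range => //; apply: leq_trans ej.
Qed.

(* [p] and [q] are the neighbours of the interval [[i, j]] on the path at time
   [k]. *)
Lemma separating_edge N (up : 'I_N -> bool) (x : 'I_N -> nat) (i j : 'I_N) k :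
  i < j ->
  (forall e, head up i j e -> x e < k) -> (forall l, tail up i j l -> k <= x l) ->
  exists p q, [/\ p < q < N.+2, separated up x p q,
    forall e, head up i j e -> early up p q e &
    forall l, tail up i j l -> late up p q l].
Proof.
move=> ij headk tailk.
(* [S] is presence on the path at time [k], as in [mem_lambda]; [P] transports it to vertices and
   adds the two extreme ones. *)
pose S (v : 'I_N) := if up v then x v < k else k <= x v.
pose P (c : 'I_N.+2) :=
  [|| val c == 0, val c == N.+1 | [exists v : 'I_N, (v.+1 == c) && S v]].
have P0 : P ord0 && ((ord0 : 'I_N.+2) <= i.+1) by rewrite /P.
have PN : P ord_max && (j.+1 <= (ord_max : 'I_N.+2)).
  by rewrite /P /= eqxx /= ltnS ltnW.
(* The bounds are weak: [p] may be the vertex of [i], and [q] that of [j]. *)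
have [p /andP[Pp pi] pmax'] :=
  @arg_maxnP _ ord0 (fun c : 'I_N.+2 => P c && (c <= i.+1)) val P0.
have {pmax'} pmax (c : 'I_N.+2) : P c && (c <= i.+1) -> c <= p by exact: pmax'.
have [q /andP[Pq qj] qmin] :=
  @arg_minnP _ ord_max (fun c : 'I_N.+2 => P c && (j.+1 <= c)) val PN.
have PS (c : 'I_N.+2) (v : 'I_N) : v.+1 = c -> P c = S v.
  move=> vc; have cN : (val c == N.+1) = false.
    by rewrite /= -vc eqSS (ltn_eqF (ltn_ord v)).
  have c0 : (val c == 0) = false by rewrite /= -vc.
  rewrite /P c0 cN /=.
  apply/existsP/idP => [[u /andP[/eqP uc]]|Sv].
    by move: uc; rewrite -vc => -[/val_inj->].
  by exists v; rewrite vc eqxx.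
(* Strictly between [i] and [j], an up value is a tail and not yet added, while a down value is a
   head and already deleted. *)
have between (v : 'I_N) : p < v.+1 < q -> S v = false.
  move=> /andP[pv vq]; apply/negP=> Sv.
  have cv : v.+1 < N.+2 by rewrite ltnS ltnW // ltnS ltn_ord.
  have Pv : P (Ordinal cv) by rewrite (PS _ v).
  have [vi|iv] := leqP v i.
    by have := pmax (Ordinal cv); rewrite Pv ltnS vi leqNgt pv => /(_ isT).
  have [jv|vj] := leqP j v.
    by have := qmin (Ordinal cv); rewrite Pv ltnS jv leqNgt vq => /(_ isT).
  move: Sv; rewrite /S; case uv: (up v).
    by rewrite ltnNge tailk // /tail uv iv vj orbT.
  by rewrite leqNgt headk // /head uv iv vj orbT.
exists (val p), (val q); split.
- rewrite ltn_ord andbT; apply: leq_ltn_trans pi _.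
  by apply: leq_trans qj; rewrite ltnS.
- move=> e l he hl; apply: (@leq_trans k).
    move: he; rewrite /early; case ue: (up e) => he; last first.
      by have := between _ he; rewrite /S ue leqNgt => /negbFE.
    have : S e by case/orP: he => /eqP he; rewrite -(PS _ _ he).
    by rewrite /S ue.
  move: hl; rewrite /late /early; case ul: (up l) => /= hl.
    by have := between _ hl; rewrite /S ul ltnNge => /negbFE.
  have : S l by case/orP: hl => /eqP hl; rewrite -(PS _ _ hl).
  by rewrite /S ul.
- move=> e he; have xe := headk _ he; have /andP[ie ej] := head_range ij he.
  rewrite /early; have [eq|eq] := eqVneq e.+1 (val q).
    by move: Pq; rewrite (PS _ _ eq) /S; case: (up e); rewrite ?orbT // leqNgt xe.
  have eb : p < e.+1 < q.
    by rewrite (leq_ltn_trans pi) //= ltn_neqAle eq (leq_trans _ qj).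
  by have := between _ eb; rewrite /S; case: (up e) => //; rewrite xe.
- move=> l hl; have xl := tailk _ hl; have /andP[il lj] := tail_range ij hl.
  rewrite /late /early; have [lp|lp] := eqVneq l.+1 (val p).
    by move: Pp; rewrite (PS _ _ lp) /S; case: (up l); rewrite //= ltnNge xl.
  have lb : p < l.+1 < q.
    by rewrite ltn_neqAle eq_sym lp (leq_trans pi) //= (leq_trans _ qj).
  by have := between _ lb; rewrite /S; case: (up l) => //=; rewrite xl.
Qed.

(** Induction on [j - i]. If all heads precede all tails in [x], one edge separates them and carries
    over to [y]. Otherwise the pair is cut at a down value into two shorter forced pairs, which
    transitivity joins again in [y]. *)
Lemma forced_of_separated N (up : 'I_N -> bool) (x y : 'I_N -> nat) :
  injective x ->
  (forall p q, p < q < N.+2 -> separated up x p q -> separated up y p q) ->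
  forall i j : 'I_N, i < j -> forced up x i j -> forced up y i j.
Proof.
move=> xI xy i j.
have [m] := ubnP (j - i); elim: m => // m IH in i j *.
move=> ltm ij F.
have Ej : head up i j j by rewrite /head eqxx.
have [d Ed dmax'] := @arg_maxnP _ j (head up i j) x Ej.
have {dmax'} dmax v : head up i j v -> x v <= x d by exact: dmax'.
case/boolP: [forall l, tail up i j l ==> (x d < x l)] => [/forallP H|].
  (* The time chosen is just after the latest head [d] has been read. *)
  have [|||p [q [pq sepx E L]]] := @separating_edge _ up x i j (x d).+1 => //.
    by move=> l Ll; have := H l; rewrite Ll.
  by apply: forced_of_heads => e l he hl; apply: xy sepx _ _ (E _ he) (L _ hl).
(* The last head [d] comes after some tail [u], and the pair splits at [d]. *)
case/forallPn=> u; rewrite negb_imply -leqNgt => /andP[Lu xud].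
have ju : x j < x u.
  have /andP[iu uj] := tail_range ij Lu.
  move/forcedP: F; apply; rewrite ?eqxx //.
  by case/orP: Lu => [->|/andP[->]]; rewrite ?orbT.
have dj : d != j by apply: contraTneq xud => ->; rewrite -ltnNge.
move: Ed; rewrite /head (negbTE dj) /= => /and3P[ud id dj'].
apply: (@forced_trans _ _ _ _ d) => //; apply: IH => //; try lia.
  by apply: forced_sub F; rewrite ?eqxx ?ud ?orbT //; lia.
(* For [l = d] the comparison holds because [d] is the latest head; every other [l] is up and
   already compared for [[i, j]]. *)
apply/forcedP=> l e dl le ej hl he.
have [ld|ld] := eqVneq l d; last first.
  move/forcedP: F; apply => //; first lia.
  by move: hl; rewrite (negbTE ld) /= => ->; rewrite orbT.
have he' : head up i j e by apply: head_of_range he => //; lia.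
rewrite ld ltn_neqAle dmax // andbT.
by apply: contraTneq le => /xI->; rewrite ld ltnn.
Qed.

(** * Permutations and their inversion sets *)

Lemma perm_ord_inj N (g : {perm 'I_N}) (i j : 'I_N) : g i = g j :> nat -> i = j.
Proof. by move=> /ord_inj/perm_inj. Qed.

(** An increasing permutation satisfies [k <= h k]; this is applied to both [g] and its inverse. *)
Lemma perm_lt_id N (g : {perm 'I_N}) :
  (forall i j : 'I_N, i < j -> g i < g j) -> g = 1%g.
Proof.
have ge_id (h : {perm 'I_N}) : (forall i j : 'I_N, i < j -> h i < h j) ->
    forall k : 'I_N, k <= h k.
  move=> hlt k; have [m] := ubnP k; elim: m => // m IH in k *.
  case: (posnP k) => [->//|k0] km.
  have k1 : k.-1 < N by have := ltn_ord k; lia.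
  have := IH (Ordinal k1); have := hlt (Ordinal k1) k; rewrite /=; lia.
move=> glt; apply/permP=> k; rewrite perm1; apply/val_inj/eqP => /=.
rewrite eqn_leq ge_id // andbT.
have := @ge_id g^-1%g _ (g k); rewrite permK; apply=> i j ij.
rewrite ltnNge leq_eqVlt; apply/negP => /orP[/eqP/perm_ord_inj ji|/glt].
  by move: ij; rewrite ji ltnn.
by rewrite !permKV; lia.
Qed.

Definition inverted N (w : {perm 'I_N}) (i j : 'I_N) : bool :=
  (w^-1)%g j < (w^-1)%g i.

Definition pos N (w : {perm 'I_N}) (v : 'I_N) : nat := (w^-1)%g v.

Lemma pos_inj N (w : {perm 'I_N}) : injective (pos w).
Proof. by move=> u v /perm_ord_inj. Qed.

Lemma inverted_asym N (w : {perm 'I_N}) (i j : 'I_N) :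
  i != j -> inverted w j i = ~~ inverted w i j.
Proof.
move=> ij; rewrite /inverted -leqNgt [RHS]leq_eqVlt; case: eqP => //= /perm_ord_inj ji.
by rewrite ji eqxx in ij.
Qed.

Lemma inverted_inj N (w w' : {perm 'I_N}) :
  (forall i j : 'I_N, i < j -> inverted w i j = inverted w' i j) -> w = w'.
Proof.
move=> ww; apply/eqP; rewrite -divg_eq1; apply/eqP/perm_lt_id => i j ij.
have neij : i != j by apply: contraTneq ij => ->; rewrite ltnn.
have wne : w i != w j by rewrite (inj_eq perm_inj).
have {}ww : inverted w (w i) (w j) = inverted w' (w i) (w j).
  have [wlt|wlt|/perm_ord_inj e] := ltngtP (w i) (w j).
  - exact: ww.
  - by rewrite inverted_asym 1?eq_sym // [RHS]inverted_asym 1?eq_sym // ww.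
  - by rewrite e eqxx in neij.
move: ww; rewrite !permM /inverted !permK => ww.
rewrite ltn_neqAle leqNgt -ww -leqNgt (ltnW ij) andbT.
by apply: contraNneq neij => /perm_ord_inj/perm_inj->.
Qed.

(** Reversing the natural order exactly on [I] gives the relation [prec]. The two hypotheses make it
    a strict total order, and the word sought lists the values in that order. *)
Lemma perm_of_inversions N (I : rel 'I_N) :
  (forall i k j : 'I_N, i < k -> k < j -> I i k -> I k j -> I i j) ->
  (forall i k j : 'I_N, i < k -> k < j -> I i j -> I i k || I k j) ->
  exists w : {perm 'I_N}, forall i j : 'I_N, i < j -> inverted w i j = I i j.
Proof.
move=> tr cotr.
pose prec (u v : 'I_N) := if u < v then ~~ I u v else (v < u) && I v u.
have prec_irr u : prec u u = false by rewrite /prec ltnn.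
have prec_total u v : u != v -> prec u v = ~~ prec v u.
  rewrite -val_eqE /= neq_ltn /prec => /orP[uv|vu].
    by rewrite uv; case: ltnP => [|_]; rewrite ?uv //; lia.
  by rewrite vu negbK /=; case: ltnP => // ; lia.
have prec_tr u v t : prec u v -> prec v t -> prec u t.
  have [->|] := eqVneq u t.
    have [->//|tv] := eqVneq t v; by rewrite prec_total // => /negbTE->.
  rewrite -val_eqE /= neq_ltn /prec => ut.
  have [uv|vu|/ord_inj->] := ltngtP u v; have [vt|tv|/ord_inj<-] := ltngtP v t;
    rewrite ?ltnn //= ?andbF // => h1 h2.
  - rewrite (ltn_trans uv vt); apply/negP=> /(cotr _ _ _ uv vt).
    by rewrite (negbTE h1) (negbTE h2).
  - case/orP: ut => [ut|tu].
      by rewrite ut; apply/negP=> h; move: h1; rewrite (tr _ _ _ ut tv).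
    have := cotr _ _ _ tu uv h2; rewrite (negbTE h1) orbF tu => ->.
    by rewrite ltnNge (ltnW tu).
  - case/orP: ut => [ut|tu].
      by rewrite ut; apply/negP=> h; move: h2; rewrite (tr _ _ _ vu ut).
    have := cotr _ _ _ vt tu h1; rewrite (negbTE h2) /= tu => ->.
    by rewrite ltnNge (ltnW tu).
  - by rewrite (tr _ _ _ tv vu) // (ltn_trans tv vu) ltnNge (ltnW (ltn_trans tv vu)).
pose rank v := #|[set u | prec u v]|.
have rank_lt u v : prec u v -> rank u < rank v.
  move=> uv; apply: proper_card; apply/properP; split.
    by apply/subsetP=> t; rewrite !inE => tu; apply: prec_tr uv.
  by exists u; rewrite !inE ?prec_irr.
have rankN v : rank v < N.
  rewrite -[X in _ < X]card_ord -cardsT; apply: proper_card; apply/properP; split=> //.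
  by exists v; rewrite !inE ?prec_irr.
have rank_inj : injective (fun v => Ordinal (rankN v)).
  move=> u v [] e; apply/eqP; apply: contraTT isT => uv.
  case/boolP: (prec u v) => [|]; last rewrite -prec_total 1?eq_sym //.
    by move/rank_lt; rewrite e ltnn.
  by move/rank_lt; rewrite e ltnn.
(* [rank] sends values to positions, so the permutation itself is the inverse. *)
exists (perm rank_inj)^-1%g => i j ij; rewrite /inverted invgK !permE /=.
have nij : i != j by rewrite -val_eqE /= neq_ltn ij.
have := prec_total _ _ nij; rewrite {1}/prec ij => H.
apply/idP/idP => [|Iij]; last first.
  by apply: rank_lt; rewrite -[prec j i]negbK -H Iij.
apply: contraTT => nI; rewrite -leqNgt ltnW // rank_lt //.
by rewrite /prec ij.
Qed.

(** * The paths and the edges of the triangulation *)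

Lemma lab_inj n : injective (lab n).
Proof. by move=> u v /(congr1 val) [] /val_inj. Qed.

Lemma vert_cases n (c : vert n) :
  [\/ c = ord0, c = ord_max | exists v, c = lab n v].
Proof.
have [c0|c0] := posnP c; first by constructor 1; apply: val_inj.
have [cN|cN] := eqVneq (val c) (n.*2).+1; first by constructor 2; apply: val_inj.
have cb : c.-1 < n.*2 by have := ltn_ord c; move: cN; rewrite /=; lia.
by constructor 3; exists (Ordinal cb); apply: val_inj; rewrite /= /bump /=; lia.
Qed.

Lemma mem_upper_chain n up (v : 'I_(n.*2)) : (lab n v \in upper_chain n up) = up v.
Proof.
rewrite /upper_chain !inE (mem_imset _ _ (@lab_inj n)) inE -!val_eqE /=.
by rewrite /bump /= add1n eqSS (ltn_eqF (ltn_ord v)).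
Qed.

Lemma mem_lower_chain n up (v : 'I_(n.*2)) : (lab n v \in lower_chain n up) = ~~ up v.
Proof. exact: (mem_upper_chain (fun v => ~~ up v)). Qed.

Lemma lambdaS n up (w : {perm 'I_(n.*2)}) (j : 'I_(n.*2)) :
  lambda n up w j.+1 = lambda_step n up w (lambda n up w j) j.
Proof.
by rewrite /lambda (take_nth j) ?size_enum_ord // foldl_rcons nth_ord_enum.
Qed.

Lemma lambda_end n up (w : {perm 'I_(n.*2)}) k : k <= n.*2 ->
  (ord0 \in lambda n up w k) /\ (ord_max \in lambda n up w k).
Proof.
elim: k => [|k IH] kn.
  by rewrite /lambda take0 /= /lambda0 /lower_chain !inE !eqxx ?orbT.
have [h0 hm] := IH (ltnW kn).
rewrite -[k.+1]/(nat_of_ord (Ordinal kn)).+1 lambdaS /lambda_step /=.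
case: ifP => _; rewrite !inE h0 hm ?orbT // ?andbT -!val_eqE /=.
by split=> //; rewrite /bump /= add1n eqSS (gtn_eqF (ltn_ord _)).
Qed.

(** Each value occurs once in the word, so its vertex changes status only at the step that reads
    it. *)
Lemma mem_lambda n up (w : {perm 'I_(n.*2)}) k v : k <= n.*2 ->
  (lab n v \in lambda n up w k) = if up v then (w^-1)%g v < k else k <= (w^-1)%g v.
Proof.
elim: k => [|k IH] kn.
  by rewrite /lambda take0 /= mem_lower_chain ltn0 leq0n; case: (up v).
rewrite -[in LHS]/(nat_of_ord (Ordinal kn)).+1 lambdaS /lambda_step /=.
set j := Ordinal kn.
have [vj|vj] := eqVneq v (w j).
  rewrite vj permK; case: ifP => _; rewrite !inE eqxx //= ?ltnSn // ltnn.
  by [].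
have -> : (lab n v \in (if up (w j) then lab n (w j) |: lambda n up w k
      else lambda n up w k :\ lab n (w j))) = (lab n v \in lambda n up w k).
  by case: ifP => _; rewrite !inE (inj_eq (@lab_inj n)) (negbTE vj).
rewrite IH ?(ltnW kn) // ltnS.
have ne : (w^-1)%g v != k :> nat.
  by apply: contraNneq vj => e; rewrite -[v](permKV w); apply/eqP; congr (w _); apply: val_inj.
by case: (up v); lia.
Qed.

Lemma lambda_edgeP n up (w : {perm 'I_(n.*2)}) (p q : vert n) : p < q ->
  [exists k : 'I_(n.*2).+1, path_edge n (lambda n up w k) (p, q)] <->
  separated up (pos w) p q.
Proof.
move=> pq; split.
  case/existsP=> k /and4P[/= pS qS _ /forallP H] e l he hl.
  have kn : k <= n.*2 by rewrite -ltnS.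
  have inside (v : 'I_(n.*2)) : p < v.+1 < q -> lab n v \notin lambda n up w k.
    move=> pvq; apply/negP=> vS; have := H (lab n v); rewrite vS /=.
    by rewrite /bump /= add1n pvq.
  have outside (v : 'I_(n.*2)) : (v.+1 == p) || (v.+1 == q) -> lab n v \in lambda n up w k.
    by case/orP=> /eqP vp; [have -> : lab n v = p by apply: val_inj
                           | have -> : lab n v = q by apply: val_inj].
  apply: (@leq_trans k).
    move: he; rewrite /early; case ue: (up e) => h.
      by have := outside _ h; rewrite mem_lambda // ue.
    by have := inside _ h; rewrite mem_lambda // ue -ltnNge.
  move: hl; rewrite /late /early; case ul: (up l) => /= h.
    by have := inside _ h; rewrite mem_lambda // ul -leqNgt.
  by have := outside _ h; rewrite mem_lambda // ul.
move=> S.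
(* The first time at which all early values have been read; it is [0] if there are none. *)
pose k := \max_(e | early up p q e) ((w^-1)%g e).+1.
have kn : k < (n.*2).+1 by rewrite ltnS; apply/bigmax_leqP=> e _.
have ke e : early up p q e -> (w^-1)%g e < k by move=> he; apply: (leq_bigmax_cond _ he).
have kl l : late up p q l -> k <= (w^-1)%g l.
  by move=> hl; apply/bigmax_leqP=> e he; apply: S.
have kn' : k <= n.*2 by [].
have [m0 mm] := lambda_end up w kn'.
have outside (v : 'I_(n.*2)) : (v.+1 == p) || (v.+1 == q) -> lab n v \in lambda n up w k.
  move=> vpq; rewrite mem_lambda //; case uv: (up v).
    by apply: ke; rewrite /early uv.
  by apply: kl; rewrite /late /early uv.
apply/existsP; exists (Ordinal kn); apply/and4P; split=> //=.
- case: (vert_cases p) pq outside => [->//|->//|[v ->]] _; apply; by rewrite eqxx.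
- case: (vert_cases q) pq outside => [->//|->//|[v ->]] _; apply; by rewrite eqxx orbT.
apply/forallP=> c; apply/implyP=> cS; apply/negP=> pcq.
case: (vert_cases c) cS pcq => [->|->|[v ->]].
- by [].
- by move=> _ /andP[_]; have := ltn_ord q; rewrite /=; lia.
move=> vS pvq; move: vS; rewrite mem_lambda //; case uv: (up v).
  by have := kl v; rewrite /late /early uv => /(_ pvq); lia.
by have := ke v; rewrite /early uv => /(_ pvq); lia.
Qed.

(** [etaB] records diagonals only, but boundary edges distinguish no words: the lower chain is the
    first path of every word, and the upper chain is the last. *)
Lemma etaB_eqP n up (x y : {perm 'I_(n.*2)}) :
  etaB n up x = etaB n up y <->
  (forall p q, p < q < (n.*2).+2 ->
     separated up (pos x) p q <-> separated up (pos y) p q).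
Proof.
split=> [E p q /andP[pq qn]|E]; last first.
  apply/setP=> -[p q]; rewrite !inE; apply: andb_id2l => /andP[/= pq _].
  have := E p q; rewrite pq ltn_ord => /(_ isT) Exy.
  apply/idP/idP => /(lambda_edgeP _ _ pq) h; apply/(lambda_edgeP _ _ pq); exact/Exy.
have pn := ltn_trans pq qn.
rewrite -(@lambda_edgeP n up x (Ordinal pn) (Ordinal qn) pq).
rewrite -(@lambda_edgeP n up y (Ordinal pn) (Ordinal qn) pq).
set e := (_, _).
have lower w : path_edge n (lower_chain n up) e ->
    [exists k : 'I_(n.*2).+1, path_edge n (lambda n up w k) e].
  by move=> h; apply/existsP; exists ord0; rewrite /lambda take0.
have upper w : path_edge n (upper_chain n up) e ->
    [exists k : 'I_(n.*2).+1, path_edge n (lambda n up w k) e].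
  move=> h; apply/existsP; exists ord_max.
  suff -> : lambda n up w (ord_max : 'I_(n.*2).+1) = upper_chain n up by [].
  have [m0 mm] := lambda_end up w (leqnn _).
  apply/setP=> c; case: (vert_cases c) => [->|->|[v ->]].
  - by rewrite m0 /upper_chain !inE eqxx.
  - by rewrite mm /upper_chain !inE eqxx orbT.
  - by rewrite mem_lambda // mem_upper_chain ltn_ord leqNgt ltn_ord; case: (up v).
have [lo|lo] := boolP (path_edge n (lower_chain n up) e).
  by split=> _; apply: lower.
have [hi|hi] := boolP (path_edge n (upper_chain n up) e).
  by split=> _; apply: upper.
have de : diagonal n up e by rewrite /diagonal lo hi !andbT; exact: pq.
by have := congr1 (fun A : {set _} => e \in A) E; rewrite /= !inE de /= => ->; split.
Qed.

(** * Signed permutations, reflections and the weak order *)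

Lemma BnP n (w : {perm 'I_(n.*2)}) :
  reflect (forall k, w (rev_ord k) = rev_ord (w k)) (w \in Bn n).
Proof. by rewrite inE; apply: (iffP forallP) => h k; apply/eqP. Qed.

Lemma Bn1 n : 1%g \in Bn n.
Proof. by apply/BnP=> k; rewrite !perm1. Qed.

Lemma BnM n (u v : {perm 'I_(n.*2)}) : u \in Bn n -> v \in Bn n -> (u * v)%g \in Bn n.
Proof. by move=> /BnP hu /BnP hv; apply/BnP=> k; rewrite !permM hu hv. Qed.

Lemma BnV n (u : {perm 'I_(n.*2)}) : u \in Bn n -> (u^-1)%g \in Bn n.
Proof. by move=> /BnP hu; apply/BnP=> k; apply: (@perm_inj _ u); rewrite hu !permKV. Qed.

(* The generator [s_i] on the ordinal encoding of signed values; for [i = 0] the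
   two transpositions coincide. *)
Definition swap_fun n (i k : nat) : nat :=
  if k == n + i then (n + i).-1 else if k.+1 == n + i then n + i
  else if k == n - i then (n - i).-1 else if k.+1 == n - i then n - i else k.

Lemma gensP n (g : {perm 'I_(n.*2)}) :
  reflect (exists2 i, i < n & forall k, g k = swap_fun n i k :> nat) (g \in gens n).
Proof.
have E (i : 'I_n) (k m : 'I_(n.*2)) : (sv n m == sgen i (sv n k)) = (val m == swap_fun n i k).
  have := ltn_ord k; have := ltn_ord m; have := ltn_ord i.
  rewrite /sv /sgen /swap_fun /=.
  move=> iN mN kN; case: (ltnP k n) => kn; case: (ltnP m n) => mn; do ?[case: ifP => ?]; lia.
rewrite inE; apply: (iffP existsP) => [[i /forallP h]|[i lti h]].
  by exists i => // k; have := h k; rewrite E => /eqP.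
exists (Ordinal lti); apply/forallP=> k; rewrite E; apply/eqP; exact: h.
Qed.

Lemma gens_Bn n (g : {perm 'I_(n.*2)}) : g \in gens n -> g \in Bn n.
Proof.
case/gensP=> i iN h; apply/BnP=> k; apply: val_inj; rewrite /= !h /= /swap_fun.
move: (ltn_ord k) => kN; do ?[case: ifP => ?]; lia.
Qed.

Lemma swap_funK n i k : i < n -> swap_fun n i (swap_fun n i k) = k.
Proof.
move=> iN; rewrite {2}/swap_fun; do ?[case: ifP => ?]; rewrite /swap_fun;
  do ?[case: ifP => ?]; lia.
Qed.

Lemma gensK n (g : {perm 'I_(n.*2)}) : g \in gens n -> (g * g)%g = 1%g.
Proof.
case/gensP=> i iN h; apply/permP=> k; apply: val_inj; rewrite permM perm1 /= !h.
exact: swap_funK.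
Qed.

Lemma gensV n (g : {perm 'I_(n.*2)}) : g \in gens n -> (g^-1)%g = g.
Proof. by move=> /gensK gg; apply/eqP; rewrite eq_invg_mul gg. Qed.

(** For [t] in [Bn n] the images of the negatives of [a] and [b] follow by symmetry, so the pair
    determines [t]. The case [b = rev_ord a] is a single transposition. *)
Definition swaps n (t : {perm 'I_(n.*2)}) (a b : 'I_(n.*2)) : Prop :=
  [/\ t a = b, t b = a &
      forall k, k \notin [:: a; b; rev_ord a; rev_ord b] -> t k = k].

(** A generator reverses the order only of two adjacent ordinals, the larger being [n + i] or
    [n - i]. *)
Lemma swaps_gens n (g : {perm 'I_(n.*2)}) (a b : 'I_(n.*2)) :
  g \in gens n -> a < b -> g b < g a -> swaps g a b.
Proof.
move=> gG ab gba; have := gensP _ gG => -[i iN h].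
move: (ltn_ord a) (ltn_ord b) => aN bN.
have {gba} : (a.+1 == n + i) && (b == n + i :> nat) || (a.+1 == n - i) && (b == n - i :> nat).
  by move: gba; rewrite !h /swap_fun; do ?[case: ifP => ?]; lia.
move=> abE; split=> [||k kab]; apply: val_inj => /=.
- by rewrite h /swap_fun; do ?[case: ifP => ?]; lia.
- by rewrite h /swap_fun; do ?[case: ifP => ?]; lia.
- by move: kab; rewrite !inE -!val_eqE /= h /swap_fun; do ?[case: ifP => ?]; lia.
Qed.

Lemma gens_adjacent n (a b : 'I_(n.*2)) :
  b = a.+1 :> nat -> exists2 g, g \in gens n & g b < g a.
Proof.
move=> ab; move: (ltn_ord b) => bN.
have [i iN ib] : exists2 i, i < n & (b == n + i :> nat) || (b == n - i :> nat).
  by have [bn|nb] := ltnP b n; [exists (n - b)|exists (b - n)]; lia.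
have fN (k : 'I_(n.*2)) : swap_fun n i k < n.*2.
  by have := ltn_ord k; rewrite /swap_fun; do ?[case: ifP => ?]; lia.
have fI : injective (fun k => Ordinal (fN k)).
  move=> k m [] e; apply: val_inj; move: e; by rewrite /= -{2}(swap_funK k iN) => ->; rewrite swap_funK.
exists (perm fI); last by rewrite !permE /= /swap_fun; do ?[case: ifP => ?]; lia.
by apply/gensP; exists i => // k; rewrite permE.
Qed.

Lemma swaps_inj n (t u : {perm 'I_(n.*2)}) (a b : 'I_(n.*2)) :
  t \in Bn n -> u \in Bn n -> swaps t a b -> swaps u a b -> t = u.
Proof.
move=> /BnP tB /BnP uB [ta tb tk] [ua ub uk]; apply/permP=> k.
have [|kab] := boolP (k \in [:: a; b; rev_ord a; rev_ord b]); last by rewrite tk ?uk.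
by rewrite !inE => /or4P[] /eqP->; rewrite ?tB ?uB ?ta ?tb ?ua ?ub.
Qed.

Lemma swaps_pair n (t : {perm 'I_(n.*2)}) (a b c d : 'I_(n.*2)) :
  t \in Bn n -> swaps t a b -> a < b -> c < d -> t c = d ->
  (c = a /\ d = b) \/ (c = rev_ord b /\ d = rev_ord a).
Proof.
move=> /BnP tB [ta tb tk] ab cd tcd; move: cd; rewrite -{}tcd => cd.
have [|cab] := boolP (c \in [:: a; b; rev_ord a; rev_ord b]); last first.
  by move: cd; rewrite (tk _ cab) ltnn.
move: (ltn_ord a) (ltn_ord b) => aN bN.
rewrite !inE => /or4P[] /eqP e; move: cd; rewrite e ?tB ?ta ?tb /=; [by left|lia|lia|by right].
Qed.

Lemma inverted_rev n (w : {perm 'I_(n.*2)}) (a b : 'I_(n.*2)) :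
  w \in Bn n -> inverted w (rev_ord b) (rev_ord a) = inverted w a b.
Proof.
move=> /BnV/BnP wB; rewrite /inverted !wB /=.
have := ltn_ord (w^-1%g a); have := ltn_ord (w^-1%g b).
by move=> h1 h2; rewrite ltn_sub2lE.
Qed.

Lemma inverted_mul N (w u : {perm 'I_N}) (a b : 'I_N) :
  inverted (w * u)%g a b = inverted w ((u^-1)%g a) ((u^-1)%g b).
Proof. by rewrite /inverted invMg !permM. Qed.

Lemma wprod_rcons n s (g : {perm 'I_(n.*2)}) : wprod n (rcons s g) = (wprod n s * g)%g.
Proof. by elim: s => [|h s /= ->] /=; rewrite ?mulg1 ?mul1g ?mulgA. Qed.

(** The exchange property, with the reflection named by a pair of values that it swaps. Induction on
    the last letter [g], which acts on values: if [g] reverses [a] and [b], it is the reflection and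
    is deleted; otherwise the reflection for [g a] and [g b] is conjugated by [g]. *)
Lemma exchange n s (a b : 'I_(n.*2)) :
  all (mem (gens n)) s -> a < b -> inverted (wprod n s) a b ->
  exists t s', [/\ t \in refls n, swaps t a b, all (mem (gens n)) s',
                   size s' < size s & wprod n s' = (wprod n s * t)%g].
Proof.
elim/last_ind: s a b => [|s g IH] a b.
  by rewrite /inverted /= invg1 !perm1 => _; lia.
rewrite all_rcons wprod_rcons inverted_mul size_rcons => /andP[/= gG sG] ab.
rewrite (gensV gG) => inv_s.
have gB := gens_Bn gG; have ggE := gensK gG.
have [gba|gab] := ltnP (g b) (g a).
  exists g, s; split=> //; first last.
  - by rewrite -mulgA ggE mulg1.
  - exact: swaps_gens.
  - by apply/imset2P; exists 1%g g => //; rewrite ?Bn1 // invg1 mul1g mulg1.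
have {}gab : g a < g b.
  rewrite ltn_neqAle gab andbT; apply: contraTneq ab => /perm_ord_inj->.
  by rewrite ltnn.
have [t [s' [tR [ta tb tk] sG' ss' ws']]] := IH _ _ sG gab inv_s.
have gK k : g (g k) = k by rewrite -permM ggE perm1.
have gr k : g (rev_ord k) = rev_ord (g k) by move/BnP: gB.
exists (g * t * g)%g, (rcons s' g); split.
- case/imset2P: tR => w h wB hG ->; apply/imset2P; exists (w * g)%g h => //.
    exact: BnM.
  by rewrite invMg (gensV gG) !mulgA.
- split; rewrite ?permM ?ta ?tb ?gK //.
  move=> k kab; rewrite !permM tk ?gK //; apply: contra kab.
  by rewrite !inE -!gr !(inj_eq perm_inj).
- by rewrite all_rcons /= gG.
- by rewrite size_rcons.
- by rewrite wprod_rcons ws' !mulgA -(mulgA _ g g) ggE mulg1.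
Qed.

Definition invset N (w : {perm 'I_N}) : {set 'I_N * 'I_N} :=
  [set c : 'I_N * 'I_N | (c.1 < c.2) && inverted w c.1 c.2].

(** Induction on the number of inversions. Without inverted adjacent values [w] is the identity;
    otherwise the generator swapping such a pair lowers the number. *)
Lemma word_exists n (w : {perm 'I_(n.*2)}) :
  w \in Bn n -> exists2 s, all (mem (gens n)) s & wprod n s = w.
Proof.
have [m] := ubnP #|invset w|; elim: m => // m IH in w *; move=> wm wB.
have [/existsP[a /existsP[b /andP[/eqP ab inv_ab]]]|noinv] :=
    boolP [exists a : 'I_(n.*2), exists b : 'I_(n.*2), (nat_of_ord b == a.+1) && inverted w a b];
    last first.
  exists [::] => //=; apply/esym/invg_inj; rewrite invg1; apply: perm_lt_id => i j.
  have [k] := ubnP (j - i); elim: k => // k IHk in i j *; move=> jik ij.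
  have step (a b : 'I_(n.*2)) : b = a.+1 :> nat -> w^-1%g a < w^-1%g b.
    move=> ab; rewrite ltn_neqAle; apply/andP; split.
      by apply/eqP=> /perm_ord_inj e; move: ab; rewrite e; lia.
    rewrite leqNgt; apply: contra noinv => inv_ab.
    by apply/existsP; exists a; apply/existsP; exists b; rewrite ab eqxx.
  have iN : i.+1 < n.*2 by have := ltn_ord j; lia.
  have [e|ne] := eqVneq (nat_of_ord j) i.+1; first exact: step.
  apply: (@ltn_trans (w^-1%g (Ordinal iN))); first exact: step.
  by apply: IHk; rewrite /=; lia.
have [g gG gba] := gens_adjacent ab.
have gB := gens_Bn gG; have ggE := gensK gG.
have ltab : a < b by lia.
have gab := swaps_gens gG ltab gba; have [ga gb _] := gab.
have [||s sG ws] := IH (w * g)%g; last first.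
- by exists (rcons s g); rewrite ?all_rcons /= ?gG // wprod_rcons ws -mulgA ggE mulg1.
- exact: BnM.
rewrite ltnS in wm; apply: leq_trans wm.
(* [f] injects the inversions of [w * g] into those of [w] and misses [(a, b)]. *)
pose f (c : 'I_(n.*2) * 'I_(n.*2)) := (g c.1, g c.2).
have fI : injective f by move=> [c d] [c' d'] [] /perm_inj-> /perm_inj->.
rewrite -(card_imset _ fI); apply: proper_card; apply/properP; split; last first.
  exists (a, b); rewrite ?inE /= ?ltab //; apply/imsetP=> -[[c d]].
  rewrite inE /= => /andP[cd _] [ac bd].
  have : g a < g b by rewrite ac bd -!permM ggE !perm1.
  by rewrite ga gb; lia.
apply/subsetP=> x /imsetP[[c d]]; rewrite inE /= => /andP[cd].
rewrite inverted_mul (gensV gG) => inv_cd ->; rewrite inE /= inv_cd andbT.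
rewrite ltnNge leq_eqVlt; apply/negP=> /orP[/eqP/perm_ord_inj e|gdc].
  by move: cd; rewrite e ltnn.
have [gc gd _] := swaps_gens gG cd gdc.
move: inv_cd; rewrite gc gd inverted_asym; last by rewrite -val_eqE /= neq_ltn cd.
by case: (swaps_pair gB gab ltab cd gc) => -[-> ->]; rewrite ?inverted_rev // inv_ab.
Qed.

Lemma length_exists n (w : {perm 'I_(n.*2)}) : w \in Bn n -> exists l, is_length n w l.
Proof.
move=> wB.
(* Words of a fixed length form a finite type, which makes [P] boolean and a minimal length
   available. *)
pose P l := [exists s : l.-tuple {perm 'I_(n.*2)}, all (mem (gens n)) s && (wprod n s == w)].
have PI s : all (mem (gens n)) s -> wprod n s = w -> P (size s).
  by move=> sG ws; apply/existsP; exists (in_tuple s); rewrite sG /= ws.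
have exP : exists l, P l.
  by have [s sG ws] := word_exists wB; exists (size s); apply: PI.
case: (ex_minnP exP) => l /existsP[s /andP[sG /eqP ws]] lmin; exists l; split.
  by exists s; rewrite size_tuple.
by move=> u uG wu; apply/lmin/PI.
Qed.

Lemma is_length_uniq n (w : {perm 'I_(n.*2)}) l l' :
  is_length n w l -> is_length n w l' -> l = l'.
Proof.
move=> [[s [sG [<- ws]]] smin] [[u [uG [<- wu]]] umin].
by apply/eqP; rewrite eqn_leq smin // umin.
Qed.

Lemma refls_swaps n t : t \in refls n ->
  t \in Bn n /\ exists a b : 'I_(n.*2), a < b /\ swaps t a b.
Proof.
case/imset2P=> w g wB gG ->.
have gB := gens_Bn gG; have wV := BnP _ (BnV wB); have /BnP wr := wB.
split; first by rewrite !BnM ?BnV.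
suff [c [d [cd [gc gd gk]]]] : exists c d : 'I_(n.*2), c < d /\ swaps g c d.
  have conj : swaps (w^-1 * g * w)%g (w c) (w d).
    split; rewrite ?permM ?permK ?gc ?gd // => k kcd.
    rewrite !permM gk ?permKV //; apply: contra kcd.
    by rewrite !inE -!wr => /or4P[] /eqP <-; rewrite permKV eqxx ?orbT.
  have [lt|lt|/perm_ord_inj e] := ltngtP (w c) (w d).
  - by exists (w c), (w d).
  - exists (w d), (w c); split=> //; case: conj => h1 h2 h3; split=> // k kcd.
    by apply: h3; apply: contra kcd; rewrite !inE => /or4P[] ->; rewrite ?orbT.
  - by move: cd; rewrite e ltnn.
have [i iN h] := gensP _ gG.
have a0 : (n - i).-1 < n.*2 by lia.
have b0 : n - i < n.*2 by lia.
exists (Ordinal a0), (Ordinal b0); rewrite /=; split; first lia.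
apply: swaps_gens => //=; first lia.
by rewrite !h /= /swap_fun; do ?[case: ifP => ?]; lia.
Qed.

(** If [w] inverts the pair, [exchange] shortens a minimal word of [w]. If not, [w * t] inverts it,
    and the same argument makes [w] shorter than [w * t]. *)
Lemma inv_setP n (w t : {perm 'I_(n.*2)}) (a b : 'I_(n.*2)) : w \in Bn n ->
  t \in refls n -> a < b -> swaps t a b -> inv_set n w t <-> inverted w a b.
Proof.
have desc u (c d : 'I_(n.*2)) : u \in Bn n -> t \in refls n -> c < d -> swaps t c d ->
    inverted u c d ->
    exists l l', [/\ is_length n u l, is_length n (u * t)%g l' & l' < l].
  move=> uB tR cd tcd inv_u; have [tB _] := refls_swaps tR.
  have [l lu] := length_exists uB; have [l' lut] := length_exists (BnM uB tB).
  exists l, l'; split=> //.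
  have [[s [sG [<- su]]] _] := lu; move: inv_u; rewrite -su => inv_u.
  have [t' [s' [tR' tcd' sG' ss' ws']]] := exchange sG cd inv_u.
  apply: leq_ltn_trans ss'; case: lut => _; apply => //.
  have [tB' _] := refls_swaps tR'.
  by rewrite ws' su (swaps_inj tB' tB tcd' tcd).
move=> wB tR ab tab; have [tB _] := refls_swaps tR; split.
  case=> _ [l [l' [lw [lwt ll']]]]; apply: contraLR ll' => ninv; rewrite -leqNgt.
  have [ta tb _] := tab.
  have tt : (t * t = 1)%g.
    apply/permP=> k; rewrite permM perm1.
    have [|kab] := boolP (k \in [:: a; b; rev_ord a; rev_ord b]).
      move/BnP: tB => tr.
      by rewrite !inE => /or4P[] /eqP->; rewrite ?tr ?ta ?tb ?tr ?ta ?tb.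
    by case: tab => _ _ tk; rewrite !tk.
  have tV : (t^-1 = t)%g by apply/eqP; rewrite eq_invg_mul tt.
  have inv_wt : inverted (w * t)%g a b.
    rewrite inverted_mul tV ta tb inverted_asym //.
    by rewrite -val_eqE /= neq_ltn ab.
  have [m [m' [hm hm' mm']]] := desc _ _ _ (BnM wB tB) tR ab tab inv_wt.
  rewrite -mulgA tt mulg1 in hm'.
  by rewrite (is_length_uniq lw hm') (is_length_uniq lwt hm) ltnW.
move=> inv_w; split=> //.
by have [l [l' [? ? ?]]] := desc _ _ _ wB tR ab tab inv_w; exists l, l'.
Qed.

(** [exchange] supplies a reflection for each inverted pair, [refls_swaps] a pair for each
    reflection. *)
Lemma weak_leP n (v w : {perm 'I_(n.*2)}) : v \in Bn n -> w \in Bn n ->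
  weak_le n v w <->
  (forall a b : 'I_(n.*2), a < b -> inverted v a b -> inverted w a b).
Proof.
move=> vB wB; split=> [vw a b ab inv_v|vw t].
  have [s sG sv] := word_exists vB; rewrite -sv in inv_v.
  have [t [_ [tR tab _ _ _]]] := exchange sG ab inv_v.
  apply/(inv_setP wB tR ab tab)/vw/(inv_setP vB tR ab tab).
  by rewrite -sv.
move=> tv; have tR := tv.1; have [_ [a [b [ab tab]]]] := refls_swaps tR.
by apply/(inv_setP wB tR ab tab)/vw/(inv_setP vB tR ab tab).
Qed.

(** * The fibers, the projection and meets *)

Lemma etaB_forcedP n up (x y : {perm 'I_(n.*2)}) :
  etaB n up x = etaB n up y <->
  (forall i j : 'I_(n.*2), i < j -> forced up (pos x) i j = forced up (pos y) i j).
Proof.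
split=> [/etaB_eqP E i j ij|E].
  by apply/idP/idP; apply: forced_of_separated => //; try exact: pos_inj;
    move=> p q pq /(E p q pq).
apply/etaB_eqP=> p q /andP[pq _].
have imp (u v : {perm 'I_(n.*2)}) :
    (forall i j : 'I_(n.*2), i < j -> forced up (pos u) i j = forced up (pos v) i j) ->
    separated up (pos u) p q -> separated up (pos v) p q.
  move=> {}E /(separated_forced _ (@pos_inj _ u) pq) S.
  apply/(separated_forced _ (@pos_inj _ v) pq) => e l he hl.
  have := S _ _ he hl; case: ltnP => le; first by rewrite E.
  have {}le : e < l.
    rewrite ltn_neqAle le andbT; apply: contraTneq hl => /ord_inj el; move: he.
    by rewrite el /late /early; case: (up l) => /=; lia.
  by rewrite E.
by split; apply: imp => // i j ij; rewrite E.
Qed.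

(** Negation exchanges up with down and left end with right end, hence the roles of [l] and [e]. *)
Lemma forced_rev N (up : 'I_N -> bool) (x : 'I_N -> nat) (i j : 'I_N) :
  (forall k, up (rev_ord k) = ~~ up k) ->
  (forall u v, x u < x v -> x (rev_ord v) < x (rev_ord u)) ->
  forced up x i j -> forced up x (rev_ord j) (rev_ord i).
Proof.
move=> upr xr /forcedP F; apply/forcedP=> l e /= jl le ei hl he.
rewrite -[l]rev_ordK -[e]rev_ordK; apply: xr.
have := ltn_ord l; have := ltn_ord e; have := ltn_ord i; have := ltn_ord j => jN iN eN lN.
apply: F => /=; [lia|lia|lia| |].
- by rewrite upr -(inj_eq rev_ord_inj) rev_ordK.
- by rewrite upr -(inj_eq rev_ord_inj) rev_ordK negbK.
Qed.

(** In the composition order of [*], multiplying by it on the left reads a word backwards, and on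
    the right negates the values. *)
Definition longest N : {perm 'I_N} := perm (@rev_ord_inj N).

Lemma longestV N : ((longest N)^-1)%g = longest N.
Proof.
apply/eqP; rewrite eq_invg_mul; apply/eqP/permP => k.
by rewrite permM !permE /= rev_ordK.
Qed.

Lemma longest_Bn n : longest n.*2 \in Bn n.
Proof. by apply/BnP=> k; rewrite !permE. Qed.

Lemma pos_longest N (w : {perm 'I_N}) v : pos (longest N * w)%g v = N - (pos w v).+1.
Proof. by rewrite /pos invMg longestV permM permE. Qed.

Lemma inverted_longest N (w : {perm 'I_N}) (i j : 'I_N) :
  i < j -> inverted (longest N * w)%g i j = ~~ inverted w i j.
Proof.
move=> ij; rewrite -inverted_asym; last by rewrite -val_eqE /= neq_ltn ij.
rewrite /inverted -[X in X < _]/(pos _ _) -[X in _ < X]/(pos _ _) !pos_longest.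
by rewrite ltn_sub2lE // ltn_ord.
Qed.

Lemma longestK N (w : {perm 'I_N}) : (longest N * (longest N * w))%g = w.
Proof. by rewrite -{1}longestV mulKg. Qed.

Lemma pi_down_exists n up (w : {perm 'I_(n.*2)}) :
  (forall k, up (rev_ord k) = ~~ up k) -> w \in Bn n ->
  exists2 p, p \in Bn n &
    forall i j : 'I_(n.*2), i < j -> inverted p i j = forced up (pos w) i j.
Proof.
move=> upr wB; have wr := BnP _ (BnV wB).
have [p pE] := @perm_of_inversions _ (forced up (pos w)) (@forced_trans _ _ _)
  (@forced_cotrans _ _ _).
exists p => //.
have posr u v : pos w u < pos w v -> pos w (rev_ord v) < pos w (rev_ord u).
  rewrite /pos !wr /= => uv.
  by have := ltn_ord ((w^-1)%g u); have := ltn_ord ((w^-1)%g v); lia.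
have forced_symm i j : forced up (pos w) (rev_ord j) (rev_ord i) = forced up (pos w) i j.
  apply/idP/idP; last exact: forced_rev.
  by move/(forced_rev upr posr); rewrite !rev_ordK.
set c := longest n.*2.
(* The set of forced pairs is stable under negation, so [p] and its conjugate have the same
   inversions; commuting with negation is membership in [Bn n]. *)
have cpc : (c * p * c = p)%g.
  apply: inverted_inj => i j ij; rewrite inverted_mul longestV !permE /=.
  have rij : rev_ord j < rev_ord i by have := ltn_ord j; rewrite /=; lia.
  rewrite inverted_asym; last by rewrite -val_eqE /= neq_ltn rij.
  by rewrite inverted_longest // negbK !pE // forced_symm.
apply/BnP=> k; have := congr1 (fun q : {perm _} => q k) cpc.
by rewrite /= !permM !permE => <-; rewrite rev_ordK.
Qed.

Lemma meet_compat n up (x y z m m' : {perm 'I_(n.*2)}) :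
  (forall k, up (rev_ord k) = ~~ up k) ->
  x \in Bn n -> y \in Bn n -> z \in Bn n ->
  etaB n up x = etaB n up y -> is_meet n m x z -> is_meet n m' y z ->
  etaB n up m = etaB n up m'.
Proof.
move=> upr.
have half (u v s t t' : {perm 'I_(n.*2)}) : u \in Bn n -> v \in Bn n -> s \in Bn n ->
    (forall i j : 'I_(n.*2), i < j -> forced up (pos u) i j = forced up (pos v) i j) ->
    is_meet n t u s -> is_meet n t' v s ->
    forall i j : 'I_(n.*2), i < j -> forced up (pos t) i j -> forced up (pos t') i j.
  move=> uB vB sB uv [tB [tu [ts _]]] [tB' [_ [_ t'max]]] i j ij F.
  have [p pB pE] := pi_down_exists upr tB.
  have pt' : weak_le n p t'.
    apply: t'max => //; apply/weak_leP => // a b ab; rewrite pE //.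
      move=> /(forced_mono (iffLR (weak_leP tB uB) tu)); rewrite uv //.
      exact: forced_inv.
    by move/(forced_inv ab); apply: (iffLR (weak_leP tB sB) ts).
  (* The projection [p] of [t] has the forced pairs of [t] and lies below [t'], so monotonicity
     passes them on. *)
  apply: (forced_mono (iffLR (weak_leP pB tB') pt')).
  by rewrite (forced_idem pE).
move=> xB yB zB /etaB_forcedP xy mx my; apply/etaB_forcedP=> i j ij.
by apply/idP/idP; [apply: half mx my i j ij|apply: half my mx i j ij] => // a b ab; rewrite xy.
Qed.

(** * Joins by duality *)

Lemma weak_le_longest n (u v : {perm 'I_(n.*2)}) : u \in Bn n -> v \in Bn n ->
  weak_le n u v -> weak_le n (longest _ * v)%g (longest _ * u)%g.
Proof.
move=> uB vB /(weak_leP uB vB) uv.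
apply/weak_leP; try by apply: BnM => //; apply: longest_Bn.
by move=> a b ab; rewrite !inverted_longest //; apply/contra/uv.
Qed.

Lemma is_join_longest n (j x z : {perm 'I_(n.*2)}) : x \in Bn n -> z \in Bn n ->
  is_join n j x z ->
  is_meet n (longest _ * j)%g (longest _ * x)%g (longest _ * z)%g.
Proof.
move=> xB zB [jB [xj [zj jmin]]].
split; first by rewrite BnM ?longest_Bn.
split; first exact: weak_le_longest.
split; first exact: weak_le_longest.
move=> u uB ux uz; have cB := longest_Bn n.
rewrite -(longestK u); apply: weak_le_longest; rewrite ?BnM //.
apply: jmin; rewrite ?BnM //.
  by rewrite -(longestK x); apply: weak_le_longest; rewrite ?BnM.
by rewrite -(longestK z); apply: weak_le_longest; rewrite ?BnM.
Qed.

(** Complementing [up] exchanges early and late values, and reading backwards exchanges before and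
    after. *)
Lemma separated_longest N (up : 'I_N -> bool) (w : {perm 'I_N}) p q :
  separated (fun v => ~~ up v) (pos (longest N * w)%g) p q <-> separated up (pos w) p q.
Proof.
have upE e : early (fun v => ~~ ~~ up v) p q e = early up p q e by rewrite /early negbK.
have ltE u v : (pos (longest N * w)%g u < pos (longest N * w)%g v) = (pos w v < pos w u).
  by rewrite !pos_longest ltn_sub2lE // ltn_ord.
split=> S e l he hl.
  by rewrite -ltE; apply: S => //; rewrite /late upE.
by rewrite ltE; apply: S => //; rewrite -upE.
Qed.

Lemma etaB_longest n up (x y : {perm 'I_(n.*2)}) :
  etaB n (fun v => ~~ up v) (longest _ * x)%g = etaB n (fun v => ~~ up v) (longest _ * y)%g
  <-> etaB n up x = etaB n up y.
Proof.
split=> /etaB_eqP E; apply/etaB_eqP=> p q /(E p q); last by rewrite !separated_longest.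
by rewrite (separated_longest up x) (separated_longest up y).
Qed.

Theorem theorem7p1 (n : nat) (up : 'I_(n.*2) -> bool) :
  (0 < n)%N ->
  (forall k : 'I_(n.*2), up (rev_ord k) = ~~ up k) ->
  exists r : {perm 'I_(n.*2)} -> {perm 'I_(n.*2)} -> Prop,
    lattice_congruence n r /\
    (forall x y, x \in Bn n -> y \in Bn n -> (r x y <-> etaB n up x = etaB n up y)).
Proof.
move=> _ upr; exists (fun x y => etaB n up x = etaB n up y); split=> //.
split=> [//|]; split=> [x y _ _ ->//|]; split=> [x y z _ _ _ -> //|].
split=> [x y z m m' xB yB zB|x y z j j' xB yB zB xy jx jy].
  exact: meet_compat.
have cB := longest_Bn n; apply/etaB_longest.
(* The complement of [up] is again centrally symmetric, so the result on meets applies to the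
   reflected polygon. *)
have upr' k : ~~ up (rev_ord k) = ~~ ~~ up k by rewrite upr.
apply: (meet_compat upr' _ _ _ _ (is_join_longest xB zB jx) (is_join_longest yB zB jy)).
- exact: BnM.
- exact: BnM.
- exact: BnM.
- exact/etaB_longest.
Qed.
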